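(* Let $\mathcal P$ and $\mathcal Q$ be properties of filtrations such that $\mathcal P\Rightarrow\mathcal Q$ and every $\mathcal Q$-filtration consists of normal subgroups, and assume hypotheses (H0), (H1), (H2), (H3), (H4) of the context. Let $K_*$ and $H_*$ be $\mathcal Q$-filtrations, and let $K_*$ act on $H_*$. Then $(H_*\rtimes K_* )^{\mathcal P}=H_*^{\mathcal P}\rtimes K_*^{\mathcal P}$; that is, the smallest $\mathcal P$-filtration on $H_1\rtimes K_1$ containing $H_*\rtimes K_*$ is the filtration whose $i$-th term is $H_i^{\mathcal P}\rtimes K_i^{\mathcal P}$.
   Context: A filtration $G_*$ on a group $G$ is a sequence of subgroups $G=G_1\supseteq G_2\supseteq\cdots$. Inclusion of filtrations is termwise. If a group $K$ acts on a group $H$ by automorphisms and $H_*$ is a filtration on $H$ by normal subgroups, then for $j\ge1$, $\mathcal A_j(K,H_* )$ is the subgroup of all $k\in K$ such that $k$ and $k^{-1}$ map each $H_i$ into itself and $(k\cdot h)h^{-1}\in H_{i+j}$ for all $i\ge1$, $h\in H_i$; $\mathcal A_*(K,H_* )$ is a filtration on the group $\mathcal A_1(K,H_* )$. Write $\mathcal A_*(H_* )=\mathcal A_*(\mathrm{Aut}(H),H_* )$. An action of $K_*$ on $H_*$ is an action of $K=K_1$ on $H=H_1$ by automorphisms such that $K_j\subseteq\mathcal A_j(K,H_* )$ for all $j\ge1$; then $H_*\rtimes K_*$ is the filtration of $H\rtimes K$ with terms $H_i\rtimes K_i$. For a property $\mathcal P$ of filtrations, a $\mathcal P$-filtration is a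 filtration satisfying $\mathcal P$. The hypotheses are: (H0) If $f\colon K\to G$ is a group morphism and $G_*$ is a $\mathcal P$-filtration on $G$, then $f^{-1}(G_* )$ is a $\mathcal P$-filtration on $K$. (H1) If $G_*$ is a $\mathcal P$-filtration, then so is $\mathcal A_*(G_* )$. (H2) If $K_*$ acts on $H_*$ and both $K_*$ and $H_*$ satisfy $\mathcal P$, then so does $H_*\rtimes K_*$. (H3) For every $\mathcal Q$-filtration $G_*$, there is a smallest $\mathcal P$-filtration $G_*^{\mathcal P}$ (on the same group) containing $G_*$. (H4) For every $\mathcal Q$-filtration $G_*$, $\mathcal A_*(G_* )\subseteq\mathcal A_*(G_*^{\mathcal P})$. In general, $G_*^{\mathcal P}$ denotes the smallest $\mathcal P$-filtration containing a filtration $G_*$ (its $\mathcal P$-envelope), with $i$-th term $G_i^{\mathcal P}$. *)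

(* Defs.v *)
From HB Require Import structures.
From mathcomp Require Import all_boot.
From mathcomp Require Import boolp classical_sets.

Set Implicit Arguments.
Unset Strict Implicit.
Unset Printing Implicit Defensive.

Local Open Scope classical_set_scope.
Local Open Scope group_scope.

Notation "{ 'ghom' G -> H }" :=
  (monoid.UMagmaMorphism.type G%type H%type)
  (G at level 98, H at level 99, format "{ 'ghom'  G  ->  H }") : type_scope.

(* A filtration G = G_1 >= G_2 >= ... is stored as a sequence indexed by nat.
   The unused term G_0 is not a degree of freedom: it contains G_1, so it is
   all of G. *)
Record filtration (G : groupType) := Filtration {
  fil :> nat -> set G;
  fil_group : forall i, group_closed (mem (fil i));
  fil1 : fil 1 = [set: G];
  fil_decr : forall i, fil i.+1 `<=` fil i }.

Definition filtration_property := forall G : groupType, filtration G -> Prop.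

Section FiltrationTheory.
Variables (G : groupType) (F : filtration G).

Lemma fil_one i : F i 1.
Proof. by have [+ _] := fil_group F i; rewrite inE. Qed.

Lemma fil_div i x y : F i x -> F i y -> F i (x / y).
Proof.
move=> Fx Fy; have [_ /(_ x y)] := fil_group F i.
by rewrite !inE; apply.
Qed.

Lemma fil_inv i x : F i x -> F i x^-1.
Proof. by move=> Fx; rewrite -[x^-1]mul1g; apply: fil_div => //; apply: fil_one. Qed.

Lemma fil_mul i x y : F i x -> F i y -> F i (x * y).
Proof. by move=> Fx Fy; rewrite -[y]invgK; apply: fil_div => //; apply: fil_inv. Qed.

Lemma group_closed_set (A : set G) : A 1 ->
  (forall x y, A x -> A y -> A (x / y)) -> group_closed (mem A).
Proof.
by move=> A1 Adiv; split=> [|x y]; rewrite !inE //; apply: Adiv.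
Qed.

End FiltrationTheory.

Definition fil_normal (G : groupType) (F : filtration G) : Prop :=
  forall i g x, F i x -> F i (x ^ g).

Definition fil_sub (G : groupType) (F E : filtration G) : Prop :=
  forall i, F i `<=` E i.

Section Preimage.
Variables (K G : groupType) (f : {ghom K -> G}) (F : filtration G).

Let pre i : set K := f @^-1` F i.

Fact pre_group i : group_closed (mem (pre i)).
Proof.
apply: group_closed_set => [|x y]; rewrite /pre /=.
  by rewrite gmulf1; apply: fil_one.
by move=> Fx Fy; rewrite gmulfF; apply: fil_div.
Qed.

Fact pre1 : pre 1 = [set: K].
Proof. by rewrite /pre fil1 preimage_setT. Qed.

Fact pre_decr i : pre i.+1 `<=` pre i.
Proof. by move=> x; apply: fil_decr. Qed.

Definition fil_preimage : filtration K := Filtration pre_group pre1 pre_decr.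

End Preimage.

(* Group automorphisms, with composition as product, so that a left action of
   K on H by automorphisms is a morphism K -> aut H. *)
Record aut (H : groupType) := Aut {
  aut_fun :> H -> H;
  autM : {morph aut_fun : x y / x * y};
  aut_bij : bijective aut_fun }.

HB.instance Definition _ (H : groupType) := gen_eqMixin (aut H).
HB.instance Definition _ (H : groupType) := gen_choiceMixin (aut H).

Section AutGroup.
Variable H : groupType.
Implicit Types f g : aut H.

Lemma aut_ext f g : f =1 g -> f = g.
Proof.
case: f g => f fM fb [g gM gb] /= /funext fg; subst g.
by congr Aut; apply: Prop_irrelevance.
Qed.

Definition aut_one : aut H :=
  @Aut H id (fun x y => erefl)
    (@Bijective H H id id (fun x => erefl) (fun x => erefl)).

Fact aut_mulM f g : {morph f \o g : x y / x * y}.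
Proof. by move=> x y /=; rewrite !autM. Qed.

Definition aut_mul f g : aut H :=
  Aut (@aut_mulM f g) (bij_comp (aut_bij f) (aut_bij g)).

Fact aut_inv_ex f : exists g : H -> H, cancel f g /\ cancel g f.
Proof. by have [g] := aut_bij f; exists g. Qed.

Definition aut_invf f : H -> H := sval (cid (aut_inv_ex f)).

Fact autK f : cancel f (aut_invf f).
Proof. by have [] := svalP (cid (aut_inv_ex f)). Qed.

Fact autVK f : cancel (aut_invf f) f.
Proof. by have [] := svalP (cid (aut_inv_ex f)). Qed.

Fact aut_invM f : {morph aut_invf f : x y / x * y}.
Proof. by move=> x y; apply: (can_inj (autK f)); rewrite autM !autVK. Qed.

Definition aut_inv f : aut H :=
  Aut (@aut_invM f) (Bijective (autVK f) (autK f)).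

Fact aut_mulA : associative aut_mul.
Proof. by move=> f g h; apply: aut_ext. Qed.

Fact aut_mul1 : left_id aut_one aut_mul.
Proof. by move=> f; apply: aut_ext. Qed.

Fact aut_1mul : right_id aut_one aut_mul.
Proof. by move=> f; apply: aut_ext. Qed.

Fact aut_mulV : left_inverse aut_one aut_inv aut_mul.
Proof. by move=> f; apply: aut_ext => x /=; rewrite autK. Qed.

Fact aut_Vmul : right_inverse aut_one aut_inv aut_mul.
Proof. by move=> f; apply: aut_ext => x /=; rewrite autVK. Qed.

HB.instance Definition _ := isGroup.Build (aut H)
  aut_mulA aut_mul1 aut_1mul aut_mulV aut_Vmul.

Lemma aut_oneE x : (1 : aut H) x = x. Proof. by []. Qed.
Lemma aut_mulE f g x : (f * g) x = f (g x). Proof. by []. Qed.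

Lemma aut1 f : f 1 = 1.
Proof. by apply: (@mulgI _ (f 1)); rewrite -autM !mulg1. Qed.

Lemma autV f x : f x^-1 = (f x)^-1.
Proof. by apply: (@mulgI _ (f x)); rewrite -autM !mulgV aut1. Qed.

End AutGroup.

Section ActFiltration.
Variables (K H : groupType) (act : {ghom K -> aut H}).

(* A_j(K, H_* ).  The definition makes sense without normality of the H_i; it
   is only used for filtrations by normal subgroups. *)
Definition act_term (F : filtration H) (j : nat) : set K :=
  [set k | (forall i h, F i h -> F i (act k h) /\ F i (act k^-1 h)) /\
           (forall i h, (1 <= i)%N -> F i h -> F (i + j)%N (act k h / h))].

Lemma actMg k l h : act (k * l) h = act k (act l h).
Proof. by rewrite gmulfM. Qed.

Lemma act1g h : act 1 h = h.
Proof. by rewrite gmulf1. Qed.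

Lemma actVK k h : act k (act k^-1 h) = h.
Proof. by rewrite -actMg mulgV act1g. Qed.

Lemma actKV k h : act k^-1 (act k h) = h.
Proof. by rewrite -actMg mulVg act1g. Qed.

Variable F : filtration H.

Fact act_term_group j : group_closed (mem (act_term F j)).
Proof.
apply: group_closed_set => [|k l [k1 k2] [l1 l2]].
  split=> i h; first by rewrite invg1 act1g.
  by rewrite act1g mulgV => _ _; apply: fil_one.
split=> i h => [Fh | i1 Fh].
  rewrite invgM invgK !actMg; split.
    by apply: (k1 _ _ _).1; apply: (l1 _ _ _).2.
  by apply: (l1 _ _ _).1; apply: (k1 _ _ _).2.
have Flh := (l1 _ _ Fh).2.
have -> : act (k / l) h / h =
    (act k (act l^-1 h) / act l^-1 h) * (act l (act l^-1 h) / act l^-1 h)^-1.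
  by rewrite actVK actMg invgM invgK mulgA mulgVK.
by apply: fil_div; [apply: k2 | apply: l2].
Qed.

Fact act_term_decr j : act_term F j.+1 `<=` act_term F j.
Proof.
move=> k [k1 k2]; split=> // i h i1 Fh.
by apply: fil_decr; rewrite -addnS; apply: k2.
Qed.

(* The group A_1(K, H_* ), on which A_*(K, H_* ) is a filtration. *)
Record act_group :=
  ActGroup { act_val :> K; act_valP : act_val \in act_term F 1 }.

HB.instance Definition _ := [isSub of act_group for act_val].
HB.instance Definition _ := [Choice of act_group by <:].
HB.instance Definition _ := SubChoice_isSubGroup.Build K
  _ act_group (act_term_group 1).

Let terms j : set act_group := [set k | act_term F j (act_val k)].

Fact act_fil_group j : group_closed (mem (terms j)).
Proof.
have [] := act_term_group j; rewrite inE => A1 Adiv.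
apply: group_closed_set => [//|x y Ax Ay].
by have := Adiv (act_val x) (act_val y); rewrite !inE; apply.
Qed.

Fact act_fil1 : terms 1 = [set: act_group].
Proof. by apply/seteqP; split=> // x _; have := valP x; rewrite inE. Qed.

Fact act_fil_decr j : terms j.+1 `<=` terms j.
Proof. by move=> x; apply: act_term_decr. Qed.

Definition act_fil : filtration act_group :=
  Filtration act_fil_group act_fil1 act_fil_decr.

Definition fil_action (E : filtration K) : Prop :=
  forall j, (1 <= j)%N -> E j `<=` act_term F j.

End ActFiltration.

(* A_j(H_* ) and A_*(H_* ), for the tautological action of Aut(H) on H. *)
Definition aut_term (H : groupType) (F : filtration H) (j : nat) :
  set (aut H) := act_term idfun F j.

Definition aut_fil (H : groupType) (F : filtration H) :
  filtration (act_group idfun F) := act_fil idfun F.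

Record sdprod (K H : groupType) (act : {ghom K -> aut H}) :=
  SDPair { sd_l : H; sd_r : K }.

HB.instance Definition _ (K H : groupType) (act : {ghom K -> aut H})
  := gen_eqMixin (sdprod act).
HB.instance Definition _ (K H : groupType) (act : {ghom K -> aut H})
  := gen_choiceMixin (sdprod act).

Section SemidirectProduct.
Variables (K H : groupType) (act : {ghom K -> aut H}).
Implicit Types x y : sdprod act.

Definition sd_one : sdprod act := SDPair act 1 1.

Definition sd_mul x y : sdprod act :=
  SDPair act (sd_l x * act (sd_r x) (sd_l y)) (sd_r x * sd_r y).

Definition sd_inv x : sdprod act :=
  SDPair act (act (sd_r x)^-1 (sd_l x)^-1) (sd_r x)^-1.

Fact sd_mulA : associative sd_mul.
Proof. by move=> x y z; rewrite /sd_mul /= autM actMg !mulgA. Qed.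

Fact sd_mul1 : left_id sd_one sd_mul.
Proof. by case=> h k; rewrite /sd_mul /= act1g !mul1g. Qed.

Fact sd_1mul : right_id sd_one sd_mul.
Proof. by case=> h k; rewrite /sd_mul /= aut1 !mulg1. Qed.

Fact sd_mulV : left_inverse sd_one sd_inv sd_mul.
Proof. by case=> h k; rewrite /sd_mul /= -autM !mulVg aut1. Qed.

Fact sd_Vmul : right_inverse sd_one sd_inv sd_mul.
Proof. by case=> h k; rewrite /sd_mul /= actVK !mulgV. Qed.

HB.instance Definition _ := isGroup.Build (sdprod act)
  sd_mulA sd_mul1 sd_1mul sd_mulV sd_Vmul.

Variables (Hf : filtration H) (Kf : filtration K).
Hypothesis HK : fil_action act Hf Kf.

Let terms i : set (sdprod act) := [set x | Hf i (sd_l x) /\ Kf i (sd_r x)].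

Lemma fil_action_stable k i h : Hf i h -> Hf i (act k h).
Proof.
have [k1 _] : act_term act Hf 1 k by apply: HK => //; rewrite fil1.
by move=> /k1[].
Qed.

Fact sd_fil_group i : group_closed (mem (terms i)).
Proof.
apply: group_closed_set => [|x y [xl xr] [yl yr]].
  by split; apply: fil_one.
split; last exact: fil_div.
apply: fil_mul => //=; do 2! apply: fil_action_stable.
exact: fil_inv.
Qed.

Fact sd_fil1 : terms 1 = [set: sdprod act].
Proof. by apply/seteqP; split=> // x _; rewrite /terms /= !fil1. Qed.

Fact sd_fil_decr i : terms i.+1 `<=` terms i.
Proof. by move=> x [xl xr]; split; apply: fil_decr. Qed.

Definition sd_fil : filtration (sdprod act) :=
  Filtration sd_fil_group sd_fil1 sd_fil_decr.

End SemidirectProduct.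

Definition is_envelope (P : filtration_property) (G : groupType)
    (F E : filtration G) : Prop :=
  [/\ P G E, fil_sub F E &
      forall E' : filtration G, P G E' -> fil_sub F E' -> fil_sub E E'].

Section Hypotheses.
Variables P Q : filtration_property.

Definition hypH0 : Prop :=
  forall (K G : groupType) (f : {ghom K -> G}) (F : filtration G),
    P F -> P (fil_preimage f F).

Definition hypH1 : Prop :=
  forall (G : groupType) (F : filtration G), P F -> P (aut_fil F).

Definition hypH2 : Prop :=
  forall (K H : groupType) (act : {ghom K -> aut H})
    (Hf : filtration H) (Kf : filtration K) (HK : fil_action act Hf Kf),
    P Kf -> P Hf -> P (sd_fil HK).

Definition hypH3 : Prop :=
  forall (G : groupType) (F : filtration G), Q F ->
    exists E : filtration G, is_envelope P F E.

Definition hypH4 : Prop :=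
  forall (G : groupType) (F E : filtration G), Q F -> is_envelope P F E ->
    forall j, (1 <= j)%N -> aut_term F j `<=` aut_term E j.

End Hypotheses.

(* Main.v *)
Require Import Defs.
From HB Require Import structures.
From mathcomp Require Import all_boot.
From mathcomp Require Import boolp classical_sets.

(** The action of [K] is a morphism from [K] to the automorphism group of [H],
    and [fil_action act Hf Kf] says that it maps each term of [Kf] into the
    corresponding term of [aut_fil Hf].  By (H4) this stays true with [HP] in
    place of [Hf], so [Kf] lies in the inverse image of [aut_fil HP].  As
    [aut_fil HP] is a [P]-filtration by (H1), its inverse image on [K] is one by
    (H0), so by minimality it contains the envelope [KP]: this is the action of
    [KP] on [HP] ([fil_action_envelope]).

    By (H2) the semidirect product of the envelopes is then a [P]-filtration.
    It is the smallest one: the inverse images of a competitor [E] under the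
    inclusions of the two factors are [P]-filtrations by (H0), so they contain
    [HP] and [KP], and every pair is the product of its two components
    ([sd_fil_sub]). *)

Set Implicit Arguments.
Unset Strict Implicit.
Unset Printing Implicit Defensive.

Local Open Scope classical_set_scope.
Local Open Scope group_scope.

(** Index 0 never carries a condition: every filtration has the whole group as
    its term there. *)
Lemma fil_subP (G : groupType) (F E : filtration G) :
  (forall i, (1 <= i)%N -> F i `<=` E i) -> fil_sub F E.
Proof.
move=> FE [|i]; last exact: FE.
by move=> x _; apply: fil_decr; rewrite fil1.
Qed.

(** By (H0) the inverse image of [E] is one of the [P]-filtrations among which
    the envelope [FP] is smallest. *)
Lemma envelope_sub_preimage (P : filtration_property) (K G : groupType)
    (f : {ghom K -> G}) (F FP : filtration K) (E : filtration G) :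
    hypH0 P -> is_envelope P F FP -> P G E -> fil_sub F (fil_preimage f E) ->
  fil_sub FP (fil_preimage f E).
Proof. by move=> H0 [_ _ FPmin] PE; apply: FPmin; apply: H0. Qed.

Section Action.
Variables (K H : groupType) (act : {ghom K -> aut H}).

Lemma act_term_aut (F : filtration H) j k :
  act_term act F j k <-> aut_term F j (act k).
Proof. by rewrite /aut_term /act_term /= gmulfV. Qed.

Section Corestriction.
Variables (F : filtration H).
Hypothesis act1F : forall k, aut_term F 1 (act k).

Definition act_corestr k : act_group idfun F :=
  ActGroup (mem_set (act1F k)).

Fact act_corestr1 : act_corestr 1 = 1.
Proof. by apply: val_inj; rewrite /= gmulf1. Qed.

Fact act_corestrM : {morph act_corestr : k l / k * l}.
Proof. by move=> k l; apply: val_inj; rewrite /= gmulfM. Qed.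

HB.instance Definition _ :=
  isMultiplicative.Build K (act_group idfun F) act_corestr act_corestrM.
HB.instance Definition _ := Multiplicative_isUMagmaMorphism.Build
  K (act_group idfun F) act_corestr act_corestr1.

End Corestriction.
End Action.

(** A larger filtration need not have larger [act_term]s, so it is (H4) that
    carries the action over to [HP].  Only then does [act] take values in the
    group of [aut_fil HP], along which [aut_fil HP] is pulled back. *)
Lemma fil_action_envelope (P Q : filtration_property)
    (K H : groupType) (act : {ghom K -> aut H})
    (Kf KP : filtration K) (Hf HP : filtration H) :
    hypH0 P -> hypH1 P -> hypH4 P Q -> Q H Hf -> fil_action act Hf Kf ->
    is_envelope P Kf KP -> is_envelope P Hf HP ->
  fil_action act HP KP.
Proof.
move=> H0 H1 H4 QH HK KPenv HPenv.
have actKf j k : (1 <= j)%N -> Kf j k -> aut_term HP j (act k).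
  by move=> j1 /(HK _ j1)/act_term_aut; apply: (H4 _ _ _ QH HPenv _ j1).
have act1HP k : aut_term HP 1 (act k) by apply: actKf => //; rewrite fil1.
pose f : {ghom K -> act_group idfun HP} := act_corestr act1HP.
have KPsub : fil_sub KP (fil_preimage f (aut_fil HP)).
  apply: (envelope_sub_preimage H0 KPenv); first by apply: H1; case: HPenv.
  by apply: fil_subP => j j1 k Kk; apply: actKf.
by move=> j _ k /KPsub Kk; apply/act_term_aut.
Qed.

Section Inclusions.
Variables (K H : groupType) (act : {ghom K -> aut H}).

Definition sd_inl (h : H) : sdprod act := SDPair act h 1.
Definition sd_inr (k : K) : sdprod act := SDPair act 1 k.

Fact sd_inlM : {morph sd_inl : x y / x * y}.
Proof. by move=> x y; congr SDPair; rewrite /= ?act1g ?mulg1. Qed.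

HB.instance Definition _ := isMultiplicative.Build H (sdprod act) sd_inl sd_inlM.
HB.instance Definition _ := Multiplicative_isUMagmaMorphism.Build
  H (sdprod act) sd_inl erefl.

Fact sd_inrM : {morph sd_inr : x y / x * y}.
Proof. by move=> x y; congr SDPair; rewrite /= aut1 mulg1. Qed.

HB.instance Definition _ := isMultiplicative.Build K (sdprod act) sd_inr sd_inrM.
HB.instance Definition _ := Multiplicative_isUMagmaMorphism.Build
  K (sdprod act) sd_inr erefl.

Lemma sd_inlr x : x = sd_inl (sd_l x) * sd_inr (sd_r x).
Proof. by case: x => h k; congr SDPair; rewrite /= ?act1g ?mulg1 ?mul1g. Qed.

(** Inclusions out of a semidirect product filtration are tested on the two
    factors because each pair of the [i]-th term is a product of two elements of
    that same term, [(h, k) = (h, 1) (1, k)]. *)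
Lemma sd_fil_sub (Hf : filtration H) (Kf : filtration K)
    (HK : fil_action act Hf Kf) (E : filtration (sdprod act)) :
  fil_sub (sd_fil HK) E <->
    fil_sub Hf (fil_preimage sd_inl E) /\ fil_sub Kf (fil_preimage sd_inr E).
Proof.
split=> [sub | [subl subr] i x [xl xr]].
  by split=> i x Fx; apply: sub; split=> //=; apply: fil_one.
by rewrite [x]sd_inlr; apply: fil_mul; [apply: subl | apply: subr].
Qed.

Lemma sd_fil_mono (Hf HP : filtration H) (Kf KP : filtration K)
    (HK : fil_action act Hf Kf) (HKP : fil_action act HP KP) :
  fil_sub Hf HP -> fil_sub Kf KP -> fil_sub (sd_fil HK) (sd_fil HKP).
Proof. by move=> subH subK i x [/subH xl /subK xr]. Qed.

End Inclusions.

Theorem lemma2p17 (P Q : filtration_property)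
  (PQ : forall (G : groupType) (F : filtration G), P G F -> Q G F)
  (Qnormal : forall (G : groupType) (F : filtration G), Q G F -> fil_normal F)
  (H0 : hypH0 P) (H1 : hypH1 P) (H2 : hypH2 P) (H3 : hypH3 P Q)
  (H4 : hypH4 P Q)
  (K H : groupType) (act : {ghom K -> aut H})
  (Kf : filtration K) (Hf : filtration H) (QK : Q K Kf) (QH : Q H Hf)
  (HK : fil_action act Hf Kf)
  (KP : filtration K) (HP : filtration H)
  (KPenv : is_envelope P Kf KP) (HPenv : is_envelope P Hf HP) :
  exists HKP : fil_action act HP KP,
    is_envelope P (sd_fil HK) (sd_fil HKP).
Proof.
have HKP := fil_action_envelope H0 H1 H4 QH HK KPenv HPenv.
have [[PKP subK _] [PHP subH _]] := (KPenv, HPenv).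
exists HKP; split; first exact: H2; first exact: sd_fil_mono.
move=> E PE /sd_fil_sub[subHE subKE]; apply/sd_fil_sub; split.
  exact: envelope_sub_preimage H0 HPenv PE subHE.
exact: envelope_sub_preimage H0 KPenv PE subKE.
Qed.
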